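(* Let $\mathbb{F}$ be a field, let $n,k\in\mathbb{N}$ with $k<n-k$, and let $$A=\left(\begin{array}{c|c}\mathbf{0}_{k,k} & \mathbf{0}_{k,n-k}\\ \hline \mathbf{0}_{n-k,k} & A_{22}\end{array}\right)\in\mathbb{M}_n(\mathbb{F}),$$ where $A_{22}\in\mathbb{M}_{n-k}(\mathbb{F})$ is an invertible non-derogatory matrix. Then for every monic polynomial $q(x)\in\mathbb{F}[x]$ of degree $n$ whose trace coincides with the trace of $A$, there exists a square-zero matrix $N\in\mathbb{M}_n(\mathbb{F})$ such that the characteristic polynomial of $A+N$ equals $q(x)$.
   Context: $\mathbb{M}_m(\mathbb{F})$ is the ring of $m\times m$ matrices over $\mathbb{F}$ and $\mathbf{0}_{r,s}$ is the $r\times s$ zero matrix. The value $k=0$ is allowed (then $A=A_{22}$). A matrix $N$ is square-zero if $N^2=0$. A square matrix is non-derogatory if its minimal polynomial equals its characteristic polynomial (equivalently, it is similar to a companion matrix). The characteristic polynomial of $B\in\mathbb{M}_n(\mathbb{F})$ is $\det(x\,\mathrm{Id}_n-B)$. The trace of a monic polynomial $x^n+a_{n-1}x^{n-1}+\dots+a_0\in\mathbb{F}[x]$ is $-a_{n-1}$. *)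

(* Defs.v *)
From HB Require Import structures.
From mathcomp Require Import all_boot all_order all_algebra.

Set Implicit Arguments.
Unset Strict Implicit.
Unset Printing Implicit Defensive.

Import GRing.Theory.
Local Open Scope ring_scope.

(* [mxminpoly] is only available in positive dimension; for the empty matrix
   the minimal and characteristic polynomials are both 1. *)
Definition nonderogatory (F : fieldType) (m : nat) : 'M[F]_m -> Prop :=
  match m with
  | 0 => fun _ => True
  | m'.+1 => fun B : 'M[F]_m'.+1 => mxminpoly B = char_poly B
  end.

Definition square_zero (F : fieldType) (m : nat) (N : 'M[F]_m) : Prop :=
  N *m N = 0.

(* For p monic of degree d, [size p] is d + 1, so this is minus the coefficient
   of 'X^(d - 1). Meaningful only for d >= 1. *)
Definition poly_trace (F : fieldType) (p : {poly F}) : F :=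
  - p`_(size p).-2.

(* Main.v *)
Require Import Defs.
From HB Require Import structures.
From mathcomp Require Import all_boot all_order all_algebra.
From mathcomp Require Import ring.

Set Implicit Arguments.
Unset Strict Implicit.
Unset Printing Implicit Defensive.

Import GRing.Theory.
Local Open Scope ring_scope.

(** Let [p] be the characteristic polynomial of [A22].  A non-derogatory matrix
    has a cyclic vector ([nonderogatory_cyclic]), so [A22] may be replaced by
    the companion matrix [L] of [p] whose rows say e_i L = e_(i+1).

    If [k = 0], the difference of the companion matrices of [q] and [p] lives in
    the last row, and equality of traces makes its diagonal entry vanish, so
    this difference squares to zero.

    If [k > 0], invertibility of [L] makes [[0, 0], [0, L]] similar to
    [[0, 0], [X, L]] for every [X] ([block_mx_diag_sim]), and [[0, Y], [0, 0]]
    squares to zero for every [Y].  It is therefore enough to complete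
    [[0, Y], [X, L]] to a matrix [M] with characteristic polynomial [q]
    ([bordered_completion]).

    For this, a polynomial column vector [u] with ('X - M) u = q e_last and two
    coprime entries forces [q] to divide the characteristic polynomial of [M],
    hence to be equal to it ([char_poly_from_vector]).  Let [Y] = [1, 0] and
    let the first k - 1 rows of [X] be those of the identity.  Solving
    ('X - M) u = 0 row by row, except for the last row, then gives on the [k]
    new coordinates the entries a_i = ('X^2 - 1)^i 'X^(k-1-i), for 0 <= i < k;
    the first and the last of these are coprime.  The last row evaluates to
    'X^k p minus the sum of rho_l h_l over l < m, where h_l is the quotient of
    [p] by 'X^(l+1), and rho_l is the combination of the a_i given by row [l] of
    [X].  So rho_l = a_l for l < k - 1, and the other rho_l are free.

    It remains to see that the free terms reach every polynomial [h] of degree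
    at most n - 2, which is where 'X^k p - q lies by equality of traces.  With
    d = m - k, the h_l for l >= k - 1 form a basis of the polynomials of degree
    at most [d], so [h] must be written as the sum of the a_i s_i with [s_i] of
    degree at most [d].  Since 'X divides every a_i but the last, choosing the
    last [s_i] so as to cancel both the top and the constant coefficients of [h]
    allows a division by 'X and an induction ([mixed_power_span]).  Both
    cancellations can be made at once exactly because d > 0. *)

(** * Coprime splitting of a least common multiple *)

(** Removing common factors with [c] from [a] one gcd at a time isolates the part
    of [a] prime to [c] without any factorization into irreducibles. *)
Lemma coprime_part (F : fieldType) (c a : {poly F}) : a != 0 ->
  exists a0 a1 N, [/\ a = a0 * a1, coprimep a0 c & a1 %| c ^+ N].
Proof.
have [n] := ubnP (size a); elim: n => // n IHn in a * => lt_a_n a_neq0.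
have [cop_ac|ncop_ac] := boolP (coprimep a c).
  by exists a, 1, 0; rewrite mulr1 cop_ac dvd1p.
set g := gcdp a c in ncop_ac.
have g_dvd_a : g %| a := dvdp_gcdl a c.
have def_a : a %/ g * g = a := divpK g_dvd_a.
have /andP[q_neq0 g_neq0] : (a %/ g != 0) && (g != 0).
  by rewrite -negb_or -mulf_eq0 def_a.
have g_gt1 : (1 < size g)%N.
  by rewrite ltn_neqAle eq_sym ncop_ac lt0n size_poly_eq0.
have [|//|a0 [a1 [N [def_q cop_a0 dvd_a1]]]] := IHn (a %/ g).
  rewrite -ltnS; apply: leq_trans lt_a_n; rewrite ltnS size_divp //.
  by rewrite ltn_subrL ltn_predRL g_gt1 size_poly_gt0.
exists a0, (a1 * g), N.+1; split=> //; first by rewrite mulrA -def_q def_a.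
by rewrite exprSr dvdp_mul // dvdp_gcdr.
Qed.

(** With [c] the quotient of [b] by the gcd [g], the primes dividing [c] are those
    with larger exponent in [b] than in [a].  Hence [a'] is the part of [a]
    prime to [c]; the complementary factor of [a] divides [g], and its product
    with [c] is [b']. *)
Lemma coprime_lcm_split (F : fieldType) (a b : {poly F}) : a != 0 -> b != 0 ->
  exists a' b', [/\ a' %| a, b' %| b, coprimep a' b',
                    a %| a' * b' & b %| a' * b'].
Proof.
move=> a_neq0 b_neq0; set g := gcdp a b; set c := b %/ g.
have def_b : c * g = b by rewrite divpK ?dvdp_gcdr.
have def_a : a %/ g * g = a by rewrite divpK ?dvdp_gcdl.
have cop : coprimep (a %/ g) c by rewrite coprimep_div_gcd ?a_neq0.
have [a0 [a1 [N [def_a01 cop_a0 dvd_a1]]]] := coprime_part c a_neq0.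
have a1_dvd_g : a1 %| g.
  have: a1 %| a %/ g * g by rewrite def_a def_a01 dvdp_mull.
  rewrite Gauss_dvdpr // coprimep_sym.
  by apply: coprimep_dvdl dvd_a1 _; apply: coprimep_expr.
exists a0, (a1 * c); split.
- by rewrite def_a01 dvdp_mulr.
- by rewrite -def_b [c * g]mulrC dvdp_mul.
- rewrite coprimepMr cop_a0 andbT; apply: coprimep_dvdl dvd_a1 _.
  exact: coprimep_expr.
- by rewrite mulrA -def_a01 dvdp_mulr.
- by rewrite mulrA -def_a01 -def_b mulrC dvdp_mul // dvdp_gcdl.
Qed.

(** * Cyclic vectors of non-derogatory matrices *)

Section CyclicVectors.

Variables (F : fieldType) (n' : nat).
Local Notation n := n'.+1.
Variable B : 'M[F]_n.

Definition krylov (d : nat) (v : 'rV[F]_n) : 'M[F]_(d, n) :=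
  \matrix_(i < d) (v *m B ^+ i).

Lemma mul_krylov (d : nat) (v : 'rV[F]_n) (u : 'rV[F]_d) :
  u *m krylov d v = v *m horner_mx B (rVpoly u).
Proof.
rewrite mulmx_sum_row.
rewrite horner_rVpoly (mulmx_sum_row u) linear_sum mulmx_sumr.
apply: eq_bigr => i _.
by rewrite !rowK linearZ /= mxvecK -scalemxAr.
Qed.

Definition is_order (v : 'rV[F]_n) (a : {poly F}) :=
  forall r, (v *m horner_mx B r == 0) = (a %| r).

(** An annihilating polynomial of least degree generates the annihilator ideal.
    Minimality is decidable, as linear independence of a Krylov family, so the
    descent needs no classical choice. *)
Lemma order_exists (v : 'rV[F]_n) : exists2 a, a != 0 & is_order v a.
Proof.
have: exists2 a, a != 0 & v *m horner_mx B a == 0.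
  exists (char_poly B); first by rewrite monic_neq0 ?char_poly_monic.
  by rewrite Cayley_Hamilton mulmx0.
case=> a; have [d] := ubnP (size a); elim: d => // d IHd in a * => lt_a a_neq0 va0.
have [free_a|] := boolP (row_free (krylov (size a).-1 v)).
  exists a => // r; apply/eqP/idP => [vr0|/dvdpP[s ->]]; last first.
    by rewrite rmorphM -[_ * _]comm_horner_mx2 mulmxA (eqP va0) mul0mx.
  rewrite /dvdp -(poly_rV_K (d := (size a).-1) (p := r %% a)); last first.
    by rewrite -ltnS prednK ?ltn_modp // size_poly_gt0.
  suff ->: poly_rV (r %% a) = 0 :> 'rV_(size a).-1 by rewrite linear0.
  apply: (row_free_inj free_a); rewrite mul0mx mul_krylov poly_rV_K; last first.
    by rewrite -ltnS prednK ?ltn_modp // size_poly_gt0.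
  move: vr0; rewrite {1}(divp_eq r a) rmorphD rmorphM /= -comm_horner_mx2.
  by rewrite mulmxDr mulmxA (eqP va0) mul0mx add0r.
rewrite -kermx_eq0 => /rowV0Pn[u /sub_kermxP]; rewrite mul_krylov => /eqP vu0 u_neq0.
apply: IHd vu0.
  rewrite -ltnS; apply: leq_trans lt_a; rewrite ltnS.
  by rewrite -[leqRHS]prednK ?size_poly_gt0 // ltnS size_poly.
by apply: contra_neq u_neq0 => e; apply: (can_inj rVpolyK); rewrite e linear0.
Qed.

Lemma order_mul (v : 'rV[F]_n) (a b : {poly F}) : b != 0 ->
  is_order v (a * b) -> is_order (v *m horner_mx B b) a.
Proof.
move=> b_neq0 ord_v r.
by rewrite -mulmxA mulmxE comm_horner_mx2 -rmorphM ord_v dvdp_mul2r.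
Qed.

Lemma order_add (v w : 'rV[F]_n) (a b : {poly F}) : coprimep a b ->
  is_order v a -> is_order w b -> is_order (v + w) (a * b).
Proof.
move=> cop ord_v ord_w r; rewrite Gauss_dvdp // mulmxDl.
apply/eqP/idP => [vwr0|/andP[]]; last first.
  by rewrite -ord_v -ord_w => /eqP-> /eqP->; rewrite addr0.
have kill (x : 'rV_n) s : x *m horner_mx B r = 0 -> x *m horner_mx B (r * s) = 0.
  by move=> e; rewrite rmorphM mulmxA e mul0mx.
have vw_kill : (v + w) *m horner_mx B r = 0 by rewrite mulmxDl.
apply/andP; split.
  rewrite -(Gauss_dvdpl r cop) -ord_v.
  have /eqP := kill _ b vw_kill; rewrite mulmxDl.
  have /eqP-> : w *m horner_mx B (r * b) == 0 by rewrite ord_w dvdp_mull.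
  by rewrite addr0.
rewrite coprimep_sym in cop; rewrite -(Gauss_dvdpl r cop) -ord_w.
have /eqP := kill _ a vw_kill; rewrite mulmxDl.
have /eqP-> : v *m horner_mx B (r * a) == 0 by rewrite ord_v dvdp_mull.
by rewrite add0r.
Qed.

Lemma order_lcm (v w : 'rV[F]_n) (a b : {poly F}) : a != 0 -> b != 0 ->
    is_order v a -> is_order w b ->
  exists x c, [/\ c != 0, is_order x c, a %| c & b %| c].
Proof.
move=> a_neq0 b_neq0 ord_v ord_w.
have [a' [b' [/dvdpP[ea def_a] /dvdpP[eb def_b] cop dvd_a dvd_b]]] :=
  coprime_lcm_split a_neq0 b_neq0.
move: a_neq0 b_neq0; rewrite def_a def_b !mulf_eq0 !negb_or.
move=> /andP[ea_neq0 a'_neq0] /andP[eb_neq0 b'_neq0].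
exists (v *m horner_mx B ea + w *m horner_mx B eb), (a' * b').
split=> //; rewrite -?def_a -?def_b ?mulf_neq0 //.
apply: order_add cop _ _; apply: order_mul => //.
  by rewrite mulrC -def_a.
by rewrite mulrC -def_b.
Qed.

(** A polynomial that kills every basis vector kills [B]; accumulating lcms over
    the basis yields one vector whose order is such a polynomial. *)
Lemma minpoly_is_order : exists v, is_order v (mxminpoly B).
Proof.
have kill m : exists v a, [/\ a != 0, is_order v a &
    forall i : 'I_n, (i < m)%N -> (delta_mx 0 i : 'rV_n) *m horner_mx B a = 0].
  elim: m => [|j [v [a [a_neq0 ord_v kill_a]]]].
    by have [a ? ?] := order_exists 0; exists 0, a.
  have [b b_neq0 ord_b] := order_exists (delta_mx 0 (inord j)).
  have [x [c [c_neq0 ord_x a_dvd_c b_dvd_c]]] :=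
    order_lcm a_neq0 b_neq0 ord_v ord_b.
  exists x, c; split=> // i; rewrite ltnS leq_eqVlt => /predU1P[def_i|lt_ij].
    by apply/eqP; rewrite -(inord_val i) def_i ord_b.
  have /dvdpP[s ->] := a_dvd_c.
  by rewrite rmorphM -[_ * _]comm_horner_mx2 mulmxA kill_a ?mul0mx.
have [v [a [a_neq0 ord_v kill_a]]] := kill n.
have a0 : horner_mx B a = 0.
  by apply/row_matrixP=> i; rewrite rowE kill_a // row0.
have a_dvd : a %| mxminpoly B by rewrite -ord_v mx_root_minpoly mulmx0.
exists v => r; rewrite ord_v; apply/idP/idP; last exact: dvdp_trans.
by apply: dvdp_trans; apply: mxminpoly_min.
Qed.

(** A linear relation between v, v B, ..., v B^(n-1) would be a nonzero polynomial
    of degree less than [n] divisible by the order of [v], which has degree [n]. *)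
Lemma nonderogatory_cyclic : mxminpoly B = char_poly B ->
  exists v, krylov n v \in unitmx.
Proof.
move=> minE; have [v ord_v] := minpoly_is_order; exists v.
rewrite -row_free_unit -kermx_eq0; apply/rowV0P => u /sub_kermxP.
rewrite mul_krylov => /eqP; rewrite ord_v minE => dvd_u.
apply: (can_inj rVpolyK); rewrite linear0; apply/eqP.
apply: contraTT dvd_u => u_neq0; apply/negP=> /(dvdp_leq u_neq0).
by rewrite size_char_poly leqNgt ltnS size_poly.
Qed.

End CyclicVectors.

(** * Similarity and characteristic polynomials *)

Section MatrixLemmas.

Variable F : fieldType.

Lemma char_poly_sim n (P A D : 'M[F]_n) :
  P \in unitmx -> P *m A = D *m P -> char_poly A = char_poly D.
Proof.
move=> P_unit PA_DP; apply: (@mulfI _ (\det P)%:P).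
  by rewrite polyC_eq0 -unitfE -unitmxE.
rewrite /char_poly -det_map_mx -det_mulmx mulrC -det_mulmx; congr (\det _).
rewrite /char_poly_mx mulmxBr mulmxBl -!map_mxM PA_DP.
by rewrite mul_mx_scalar mul_scalar_mx.
Qed.

Lemma square_zero_sim n (V A D K : 'M[F]_n) : V \in unitmx ->
    V *m A = D *m V -> K *m K = 0 ->
  exists N, square_zero N /\ char_poly (A + N) = char_poly (D + K).
Proof.
move=> V_unit VA_DV KK; exists (invmx V *m K *m V); split.
  by rewrite /square_zero !mulmxA mulmxK // -(mulmxA (invmx V)) KK mulmx0 mul0mx.
apply: (char_poly_sim V_unit).
by rewrite mulmxDr mulmxDl VA_DV !mulmxA mulmxV // mul1mx.
Qed.

(** Multiplying by the adjugate shows that [q] divides the product of the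
    characteristic polynomial with each entry of [u]; a Bezout relation between
    two entries then removes [u].  This replaces an expansion of the
    determinant. *)
Lemma char_poly_from_vector n (M : 'M[F]_n) (u : 'cV[{poly F}]_n) q
    (l i j : 'I_n) :
    q \is monic -> size q = n.+1 ->
    char_poly_mx M *m u = q *: delta_mx l 0 ->
    coprimep (u i 0) (u j 0) ->
  char_poly M = q.
Proof.
move=> q_monic sz_q Mu /Bezout_eq1_coprimepP[[s t] /= bez].
have dvd_u r : q %| char_poly M * u r 0.
  have := congr1 (fun v : 'cV__ => (\adj (char_poly_mx M) *m v) r 0) Mu.
  rewrite /= mulmxA mul_adj_mx mul_scalar_mx -scalemxAr !mxE => ->.
  exact: dvdp_mulIl.
apply/eqP; rewrite eq_sym -eqp_monic ?char_poly_monic // -dvdp_size_eqp.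
  by rewrite sz_q size_char_poly.
by rewrite -[char_poly M]mulr1 -bez mulrDr dvdp_add // mulrCA dvdp_mull.
Qed.

(** The dimension is a parameter here, rather than a function of [size p], to
    avoid casts. *)
Definition companion_rows m (p : {poly F}) : 'M[F]_m :=
  \matrix_(i, j) if i.+1 == m then - p`_j else (i.+1 == j)%:R.

Lemma companion_rows_mul m (p : {poly F}) (w : nat -> {poly F}) (i : 'I_m) :
  \sum_(j < m) (companion_rows m p i j)%:P * w j
    = if i.+1 == m then - \sum_(j < m) p`_j *: w j else w i.+1.
Proof.
have [im|im] := ifPn.
  rewrite -sumrN; apply: eq_bigr => j _.
  by rewrite mxE im rmorphN mulNr mul_polyC.
have lt_im : (i.+1 < m)%N by rewrite ltn_neqAle im ltn_ord.
rewrite (bigD1 (Ordinal lt_im)) //= big1 => [|j]; rewrite mxE (negPf im).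
  by rewrite eqxx mul1r addr0.
by rewrite -val_eqE eq_sym /= => /negPf->; rewrite mul0r.
Qed.

Lemma char_poly_companion_rows m (q : {poly F}) :
  q \is monic -> size q = m.+2 -> char_poly (companion_rows m.+1 q) = q.
Proof.
move=> q_monic sz_q.
apply: (@char_poly_from_vector _ _ (\col_i 'X^i) q ord_max 0 0) => //.
  apply/colP=> i; rewrite mulmxBl mul_scalar_mx !mxE.
  under eq_bigr => j _ do rewrite [in X in X * _]mxE [in X in _ * X]mxE.
  rewrite (companion_rows_mul q (fun j => 'X^j)) -val_eqE /= eqSS eqxx andbT.
  case: eqP => [->|_]; last by rewrite -exprS subrr mulr0.
  rewrite mulr1 opprK -exprS -[RHS]coefK poly_def sz_q [RHS]big_ord_recr /=.
  have /eqP := q_monic; rewrite lead_coefE sz_q /= => ->.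
  by rewrite scale1r addrC.
by rewrite !mxE coprimep1.
Qed.

(** The rows v B^i are shifted by [B], and Cayley-Hamilton rewrites v B^(n+1). *)
Lemma krylov_companion n (B : 'M[F]_n.+1) (v : 'rV[F]_n.+1) :
  krylov B n.+1 v *m B = companion_rows n.+1 (char_poly B) *m krylov B n.+1 v.
Proof.
apply/row_matrixP=> i; rewrite !row_mul mul_krylov rowK -mulmxA mulmxE -exprSr.
congr (v *m _); set p := char_poly B.
have [im|im] := eqVneq i.+1 n.+1; last first.
  rewrite (_ : rVpoly _ = 'X^(i.+1) :> {poly F}) ?rmorphXn /= ?horner_mx_X //.
  have lt_im : (i.+1 < n.+1)%N by rewrite ltn_neqAle im ltn_ord.
  rewrite -(rVpoly_delta _ (Ordinal lt_im)); congr rVpoly; apply/rowP=> j.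
  by rewrite !mxE (negPf im) -val_eqE /= eq_sym.
rewrite (_ : rVpoly _ = 'X^(i.+1) - p :> {poly F}).
  by rewrite rmorphB /= Cayley_Hamilton subr0 rmorphXn /= horner_mx_X.
have p_top : p`_n.+1 = 1.
  by have /eqP := char_poly_monic B; rewrite lead_coefE size_char_poly.
apply/polyP=> j; rewrite coefB coefXn im coef_rVpoly.
case: insubP => [j' lt_j <-|]; first by rewrite !mxE im eqxx ltn_eqF //= sub0r.
rewrite -leqNgt leq_eqVlt => /predU1P[<-|lt_j]; first by rewrite eqxx p_top subrr.
by rewrite gtn_eqF // nth_default ?subr0 // size_char_poly.
Qed.

End MatrixLemmas.

(** * Representing polynomials of bounded degree *)

Section PolynomialLemmas.

Variable F : fieldType.
Implicit Types (p g h s : {poly F}).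

(** Polynomials of all degrees below [N], here in decreasing order, form a basis of
    the polynomials of degree below [N]. *)
Lemma triangular_span N l0 (g : nat -> {poly F}) s :
    (forall t, (t < N)%N -> size (g (l0 + t)%N) = (N - t)%N) ->
    (size s <= N)%N ->
  exists c : nat -> F, s = \sum_(l0 <= l < l0 + N) c l *: g l.
Proof.
elim: N l0 s => [|N IHN] l0 s sz_g sz_s.
  exists (fun=> 0); rewrite addn0 big_geq //; apply/eqP.
  by rewrite -size_poly_leq0.
have sz_g0 : size (g l0) = N.+1 by rewrite -(addn0 l0) sz_g ?subn0.
have lead_neq0 : (g l0)`_N != 0.
  have := lead_coef_eq0 (g l0).
  by rewrite lead_coefE -size_poly_eq0 sz_g0 => ->.
set a := s`_N / (g l0)`_N.
have [t lt_tN||c def_s] := IHN l0.+1 (s - a *: g l0).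
- by rewrite addSnnS sz_g.
- apply/leq_sizeP=> j; rewrite leq_eqVlt coefB coefZ => /predU1P[<-|lt_Nj].
    by rewrite mulfVK // subrr.
  rewrite nth_default; last exact: leq_trans lt_Nj.
  by rewrite nth_default ?mulr0 ?subrr // sz_g0.
exists (fun l => if l == l0 then a else c l).
rewrite big_ltn ?addnS ?ltnS ?leq_addr // eqxx; apply/eqP.
rewrite addrC -subr_eq def_s addSn; apply/eqP/eq_big_nat => l /andP[lt_l _].
by rewrite gtn_eqF.
Qed.

(** The homogeneous monomials of degree [k] in the coprime pair 'X, 'X^2 - 1. *)
Definition mixed_power (k i : nat) : {poly F} := ('X^2 - 1) ^+ i * 'X^(k - i).

Lemma size_mixed_power k i : (i <= k)%N -> size (mixed_power k i) = (k + i).+1.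
Proof.
move=> le_ik; rewrite /mixed_power.
have X21_monic : ('X^2 - 1 : {poly F}) \is monic by rewrite monicXnsubC.
have X21_exp_neq0 : ('X^2 - 1 : {poly F}) ^+ i != 0.
  by rewrite monic_neq0 ?monic_exp.
rewrite size_Mmonic ?monicXn // size_polyXn addnS /=.
rewrite -[size _]prednK ?size_poly_gt0 // size_exp size_XnsubC //=.
by rewrite addSn mul2n -addnn -addnA subnKC // addnC.
Qed.

(** The induction divides by 'X, which divides every summand but the last.  The
    last coefficient is chosen of the shape alpha 'X^d + beta, where alpha cancels
    the top coefficient of [h] and beta the constant one. *)
Lemma mixed_power_span k d h : (0 < d)%N -> (size h <= d + k.*2.+1)%N ->
  exists s : nat -> {poly F}, (forall i, size (s i) <= d.+1)%N /\
    h = \sum_(i < k.+1) mixed_power k i * s i.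
Proof.
move=> d_gt0; elim: k h => [|k IHk] h sz_h.
  exists (fun=> h); split=> [_|]; first by rewrite addn1 in sz_h.
  by rewrite big_ord1 /mixed_power !expr0 !mul1r.
set b : {poly F} := ('X^2 - 1) ^+ k.+1.
have b_monic : b \is monic by rewrite monic_exp // monicXnsubC.
have b_last : mixed_power k.+1 k.+1 = b by rewrite /mixed_power subnn mulr1.
have sz_b : size b = k.+1.*2.+1 by rewrite -b_last size_mixed_power // addnn.
have b0 : b`_0 = (-1) ^+ k.+1.
  by rewrite -horner_coef0 /b !hornerE expr0n /= sub0r.
pose t := h`_(d + k.+1.*2) *: 'X^d + ((-1) ^+ k.+1 * h`_0)%:P.
have sz_t : (size t <= d.+1)%N.
  rewrite (leq_trans (size_polyD _ _)) // geq_max.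
  rewrite (leq_trans (size_scale_leq _ _)) ?size_polyXn //.
  by rewrite (leq_trans (size_polyC_leq1 _)).
have h'0 : (h - b * t)`_0 = 0.
  rewrite coefB -[(b * t)`_0]horner_coef0 hornerM !horner_coef0 b0.
  rewrite /t coefD coefZ coefXn coefC eq_sym eqn0Ngt d_gt0 mulr0 add0r.
  by rewrite signrMK subrr.
have sz_h' : (size (h - b * t)%R <= d + k.+1.*2)%N.
  apply/leq_sizeP=> j; rewrite leq_eqVlt coefB => /predU1P[<-|lt_j].
    rewrite /t mulrDr -scalerAr coefD coefZ coefMXn ltnNge leq_addr /= addKn.
    have /eqP := b_monic; rewrite lead_coefE sz_b /= => ->.
    rewrite mulr1 coefMC [b`_(_ + _)]nth_default ?mul0r ?addr0 ?subrr //.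
    by rewrite sz_b -add1n leq_add2r.
  rewrite nth_default; last by apply: leq_trans sz_h _; rewrite addnS.
  rewrite nth_default ?subrr // (leq_trans (size_polyMleq _ _)) // sz_b.
  by apply: leq_trans lt_j; rewrite addSn /= addnC -addSn leq_add2r.
have [|s [sz_s def_s]] := IHk (drop_poly 1 (h - b * t)).
  by rewrite size_drop_poly leq_subLR add1n -addnS -doubleS.
exists (fun i => if i == k.+1 then t else s i); split=> [i|]; first by case: eqP.
rewrite big_ord_recr /= eqxx b_last.
apply/eqP; rewrite -subr_eq; apply/eqP.
rewrite -{1}(poly_take_drop 1 (h - b * t)) def_s mulr_suml.
rewrite (_ : take_poly 1 _ = 0) ?add0r; last first.
  by apply/polyP=> -[|j]; rewrite coef_take_poly ?coef0 //=.
apply: eq_bigr => i _; have le_ik : (i <= k)%N by rewrite -ltnS.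
rewrite ltn_eqF // /mixed_power subSn //; move: (k - i)%N => e.
by rewrite (exprS _ e) expr1; ring.
Qed.

(** Horner's rule perturbed by [rho]: with [rho] zero, [w] is w_0 times the powers
    of 'X, and each perturbation propagates along the tail of [p] above it. *)
Lemma horner_telescope (w rho : nat -> {poly F}) p :
    (forall j, w j.+1 = 'X * w j - rho j) -> forall j,
  \sum_(i < j) p`_i *: w i + w j * drop_poly j p
    + \sum_(l < j) rho l * drop_poly l.+1 p = w 0%N * p.
Proof.
move=> wS; elim=> [|j IHj]; first by rewrite !big_ord0 drop_poly0l add0r addr0.
rewrite -IHj !big_ord_recr /= wS.
have -> : drop_poly j p = (p`_j)%:P + 'X * drop_poly j.+1 p.
  apply/polyP=> -[|i]; rewrite coefD coefC coefXM !coef_drop_poly /= ?addr0 //.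
  by rewrite add0r addnS.
rewrite -mul_polyC; ring.
Qed.

End PolynomialLemmas.

(** * Completing a companion block below a zero block *)

(** The zero block has dimension [k.+1]. *)
Section Completion.

Variables (F : fieldType) (k m : nat) (p q : {poly F}).
Hypotheses (lt_km : (k.+1 < m)%N).
Hypotheses (p_monic : p \is monic) (sz_p : size p = m.+1).
Hypotheses (q_monic : q \is monic) (sz_q : size q = (k.+1 + m).+1).
Hypothesis same_trace : q`_(k + m) = p`_m.-1.

Local Notation a := (mixed_power F k).
Local Notation tail l := (drop_poly l.+1 p).

(** The terms with l < k are imposed by the identity rows of the bordering block;
    the [c i l] are its remaining entries. *)
Lemma prescribed_combination :
  exists c : nat -> nat -> F,
    'X^(k.+1) * p - q = \sum_(0 <= l < k) a l * tail l
      + \sum_(k <= l < m) (\sum_(i < k.+1) c i l *: a i) * tail l.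
Proof.
set h := 'X^(k.+1) * p - q - \sum_(0 <= l < k) a l * tail l.
have sz_h : (size h <= k + m)%N.
  rewrite (leq_trans (size_polyD _ _)) // size_polyN geq_max; apply/andP; split.
    (* Both polynomials are monic of degree k + m + 1, with equal traces. *)
    apply/leq_sizeP=> j; rewrite coefB coefXnM leq_eqVlt => /predU1P[<-|].
      rewrite same_trace ltnNge -addn1 leq_add2l (leq_trans _ lt_km) //=.
      by rewrite subnDl subn1 subrr.
    rewrite leq_eqVlt => /predU1P[<-|lt_j].
      rewrite -addSn ltnNge leq_addr /= addKn.
      have /eqP := p_monic; have /eqP := q_monic.
      rewrite !lead_coefE sz_p sz_q /= => -> ->.
      by rewrite subrr.
    rewrite ltnNge ltnW ?(leq_trans _ lt_j) ?ltnS ?leq_addr //=.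
    rewrite !nth_default ?subrr ?sz_q ?addSn ?sz_p //.
    by rewrite ltn_subRL addSn.
  rewrite (leq_trans (size_sum _ _ _)) //; apply/bigmax_leqP_seq=> l.
  rewrite mem_index_iota => /= lt_lk _.
  have sz_l := size_mixed_power F (ltnW lt_lk).
  rewrite (leq_trans (size_polyMleq _ _)) // sz_l size_drop_poly sz_p subSS.
  by rewrite addSn /= -addnA subnKC // ltnW // (ltn_trans lt_lk) // ltnW.
have d_gt0 : (0 < m - k.+1)%N by rewrite subn_gt0.
have [|s [sz_s def_h]] := mixed_power_span (k := k) (h := h) d_gt0.
  by rewrite -addnn -addSn addnA subnK 1?(addnC m) // ltnW.
have sz_s' i : (size (s i) <= m - k)%N.
  by rewrite (leq_trans (sz_s i)) // subnSK // ltnW.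
have span i : exists c : nat -> F, s i = \sum_(k <= l < m) c l *: tail l.
  have [t lt_t|c def_s] :=
    triangular_span (l0 := k) (g := fun l => tail l) _ (sz_s' i).
    by rewrite size_drop_poly sz_p subSS subnDA.
  by exists c; rewrite def_s subnKC // ltnW // ltnW.
have [c def_s] := fin_all_exists (fun i : 'I_k.+1 => span i).
exists (fun i l => c (inord i) l).
rewrite [RHS]addrC; apply/eqP; rewrite -subr_eq -/h def_h; apply/eqP.
under eq_bigr => i _ do rewrite def_s mulr_sumr.
rewrite exchange_big /=; apply: eq_bigr => l _.
rewrite mulr_suml; apply: eq_bigr => i _.
by rewrite inord_val -scalerAr -scalerAl.
Qed.

(** The vector [u] has entries [a i] on the new coordinates and [w j] on the old
    ones.  Row [j] of ('X - M) u = 0 reads w_(j+1) = 'X w_j - rho_j, which is taken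
    as the definition of [w]; the value left in the last row is computed by
    [horner_telescope]. *)
Lemma bordered_completion :
  exists (Y : 'M[F]_(k.+1, m)) (X : 'M[F]_(m, k.+1)),
    char_poly (block_mx 0 Y X (companion_rows m p)) = q.
Proof.
have [c def_q] := prescribed_combination.
pose x (j i : nat) : F := if (j < k)%N then (i == j)%:R else c i j.
pose rho (j : nat) := \sum_(i < k.+1) x j i *: a i.
pose w := fix w j := if j is j'.+1 then 'X * w j' - rho j' else 'X^(k.+1).
have rho_lt j : (j < k)%N -> rho j = a j.
  move=> lt_jk; have lt_jk1 : (j < k.+1)%N by rewrite ltnW.
  rewrite /rho (bigD1 (Ordinal lt_jk1)) //= big1 => [|i]; rewrite /x lt_jk.
    by rewrite eqxx scale1r addr0.
  by rewrite -val_eqE /= => /negPf->; rewrite scale0r.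
(* This is the new row [j] of ('X - M) u = 0. *)
have w_le j : (j <= k)%N -> w j = 'X * a j.
  elim: j => [|j IHj] lt_jk; first by rewrite /= /mixed_power subn0 mul1r exprS.
  rewrite [LHS]/= IHj 1?ltnW // rho_lt // /mixed_power.
  rewrite -[(k - j)%N]prednK ?subn_gt0 //.
  by rewrite -subnS (exprS _ (k - j.+1)) (exprS _ j); ring.
have w_top : w m + \sum_(j < m) p`_j *: w j = q.
  have := horner_telescope p (fun j => erefl (w j.+1)) m.
  have -> : drop_poly m p = 1.
    apply/polyP=> j; rewrite coef_drop_poly coef1; case: j => [|j].
      by have /eqP := p_monic; rewrite lead_coefE sz_p.
    by rewrite nth_default // sz_p addSn ltnS leq_addl.
  rewrite mulr1 [X in X + _ = _]addrC => /(canRL (addrK _)) ->.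
  rewrite -[RHS](subKr ('X^(k.+1) * p)) def_q; congr (_ - _).
  have lt_km' : (k <= m)%N by rewrite ltnW // ltnW.
  rewrite -(big_mkord xpredT (fun l => rho l * tail l)).
  rewrite (@big_cat_nat _ _ _ k) //=.
  congr (_ + _); apply: eq_big_nat => l /andP[le_l lt_l].
    by rewrite rho_lt.
  by rewrite /rho /x ltnNge le_l.
have m_gt0 : (0 < m)%N by apply: leq_trans lt_km.
pose Y : 'M[F]_(k.+1, m) := \matrix_(i, j) (i == j :> nat)%:R.
pose X : 'M[F]_(m, k.+1) := \matrix_(j, i) x j i.
exists Y, X.
pose u : 'cV[{poly F}]_(k.+1 + m) := col_mx (\col_i a i) (\col_j w j).
have last_lt : (m.-1 < m)%N by rewrite prednK.
apply: (@char_poly_from_vector _ _ _ u q (rshift k.+1 (Ordinal last_lt))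
          (lshift m ord0) (lshift m ord_max)) => //; last first.
  (* The first and last entries of [a] are 'X^k and ('X^2 - 1)^k. *)
  rewrite /u !col_mxEu !mxE /mixed_power subn0 subnn mul1r mulr1.
  apply/coprimep_expl/coprimep_expr/Bezout_eq1_coprimepP.
  by exists ('X, -1) => /=; rewrite expr2; ring.
have -> : q *: delta_mx (rshift k.+1 (Ordinal last_lt)) 0
          = col_mx 0 (q *: delta_mx (Ordinal last_lt) 0) :> 'cV_(k.+1 + m).
  apply/colP=> r; case: (split_ordP r) => i ->.
    by rewrite col_mxEu !mxE eq_lrshift mulr0.
  by rewrite col_mxEd !mxE eq_rshift.
rewrite /char_poly_mx map_block_mx map_mx0 mulmxBl mul_scalar_mx /u.
rewrite mul_block_col mul0mx add0r scale_col_mx opp_col_mx add_col_mx.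
congr (col_mx _ _); apply/colP=> i; rewrite !mxE.
  have lt_im : (i < m)%N by apply: leq_trans (ltn_ord i) (ltnW lt_km).
  rewrite (bigD1 (Ordinal lt_im)) //= big1 ?addr0 => [|j]; rewrite !mxE /=.
    by rewrite eqxx mul1r w_le ?subrr // -ltnS.
  by rewrite -val_eqE eq_sym /= => /negPf->; rewrite mul0r.
rewrite (_ : \sum_j _ = rho i); last first.
  by apply: eq_bigr => j _; rewrite !mxE mul_polyC.
rewrite (_ : \sum_j _ =
    if i.+1 == m then - \sum_(j < m) p`_j *: w j else w i.+1); last first.
  rewrite -companion_rows_mul; apply: eq_bigr => j _.
  by rewrite mxE [in X in _ * X]mxE.
rewrite eqxx andbT -val_eqE /= -[(i == m.-1 :> nat)]eqSS prednK //.
case: eqP => [im|_]; last by rewrite /= mulr0 opprD addrA subrr.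
rewrite mulr1 -w_top opprD opprK addrA; congr (_ + _).
by rewrite -[in RHS]im.
Qed.

End Completion.

(** * Assembling the square-zero perturbation *)

(** Since [L] is invertible, S = - L^-1 X solves X + L S = 0, and conjugation by the
    unipotent [[1, 0], [S, 1]] clears [X]. *)
Lemma block_mx_diag_sim (F : fieldType) (k m : nat) (P A L : 'M[F]_m)
    (X : 'M[F]_(m, k)) : P \in unitmx -> L \in unitmx -> P *m A = L *m P ->
  exists2 V, V \in unitmx &
    V *m block_mx 0 0 0 A = block_mx (0 : 'M_k) 0 X L *m V.
Proof.
move=> P_unit L_unit PA_LP.
exists (block_mx 1%:M 0 (- (invmx L *m X)) P).
  by rewrite unitmxE det_lblock det1 mul1r -unitmxE.
rewrite !mulmx_block !mulmx0 !mul0mx !addr0 !add0r mulmx1 PA_LP.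
by rewrite mulmxN mulKVmx // subrr.
Qed.

Lemma block_mx_dim0 (F : fieldType) (m : nat) (A : 'M[F]_m) :
  block_mx (0 : 'M_0) 0 0 A = A.
Proof.
apply/matrixP=> i j.
have rE (x : 'I_m) : x = rshift 0 x by apply: val_inj.
by rewrite [in LHS](rE i) [in LHS](rE j) block_mxEdr.
Qed.

(** The difference is concentrated in the last row, so only its last diagonal
    entry, which is p_m - q_m, contributes to the square. *)
Lemma companion_rows_sub_sq (F : fieldType) (m : nat) (p q : {poly F}) :
    p`_m = q`_m ->
  let K := companion_rows m.+1 q - companion_rows m.+1 p in K *m K = 0.
Proof.
move=> eq_pq K; apply/matrixP=> i j; rewrite !mxE big1 // => l _; rewrite !mxE.
rewrite !eqSS; case: (l =P m :> nat) => [->|_]; last by rewrite subrr mulr0.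
case: ifP => _; last by rewrite subrr mul0r.
by rewrite eq_pq subrr mul0r.
Qed.

Theorem theorem2p3 (F : fieldType) (k m : nat) (hkm : (k < m)%N)
    (A22 : 'M[F]_m) (A22_unit : A22 \in unitmx)
    (A22_nonderog : nonderogatory A22) :
  let A : 'M[F]_(k + m) :=
    block_mx (0 : 'M[F]_(k, k)) (0 : 'M[F]_(k, m))
             (0 : 'M[F]_(m, k)) A22 in
  forall q : {poly F}, q \is monic -> size q = (k + m).+1 ->
    poly_trace q = \tr A ->
    exists N : 'M[F]_(k + m), square_zero N /\ char_poly (A + N) = q.
Proof.
case: m => // m in hkm A22 A22_unit A22_nonderog * => A q q_monic sz_q.
set p := char_poly A22.
move=> tr_q.
have same_trace : q`_(k + m) = p`_m.
  apply: oppr_inj; rewrite (char_poly_trace A22) // opprK.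
  have <- : \tr A = \tr A22 by rewrite mxtrace_block mxtrace0 add0r.
  rewrite -tr_q.
  by rewrite /poly_trace sz_q /= [(k + m.+1)%N in RHS]addnS.
have [v P_unit] := nonderogatory_cyclic A22_nonderog.
have PA_LP := krylov_companion A22 v.
set P := krylov A22 m.+1 v in P_unit PA_LP.
set L := companion_rows m.+1 p in PA_LP.
have L_unit : L \in unitmx.
  have: L *m P \in unitmx by rewrite -PA_LP unitmx_mul P_unit.
  by rewrite unitmx_mul P_unit andbT.
case: k => [|k] in hkm A sz_q tr_q same_trace *.
  rewrite /A block_mx_dim0; have KK := companion_rows_sub_sq (esym same_trace).
  have [N [N_sq char_N]] := square_zero_sim P_unit PA_LP KK.
  exists N; split=> //.
  by rewrite char_N addrC subrK char_poly_companion_rows.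
have same_trace' : q`_(k + m.+1) = p`_m by rewrite addnS -addSn.
have [Y [X char_XY]] := bordered_completion hkm (char_poly_monic A22)
  (size_char_poly A22) q_monic sz_q same_trace'.
have [V V_unit VA_DV] := block_mx_diag_sim X P_unit L_unit PA_LP.
pose K : 'M[F]_(k.+1 + m.+1) := block_mx 0 Y 0 0.
have KK : K *m K = 0.
  by rewrite /K mulmx_block !mulmx0 !mul0mx !addr0 block_mx0.
have [N [N_sq char_N]] := square_zero_sim V_unit VA_DV KK.
exists N; split=> //.
by rewrite char_N /K add_block_mx !addr0 !add0r.
Qed.
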